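(* Let $\mathcal H$ and $\mathcal G$ be real Hilbert spaces, let $f\in\Gamma_0(\mathcal H)$, let $g\in\Gamma_0(\mathcal G)$, let $L\colon\mathcal H\to\mathcal G$ be linear and bounded, let $z\in\mathcal H$, and let $r\in\mathcal G$. Suppose that $L\neq 0$ and that $$z\in\operatorname{ran}\big(\partial f+L^*\circ(\partial g)\circ(L\cdot-r)\big).$$ Consider the primal problem $$\underset{x\in\mathcal H}{\text{minimize}}\;\; f(x)+g(Lx-r)-\langle x\mid z\rangle,\qquad\text{(P)}$$ and the dual problem $$\underset{v\in\mathcal G}{\text{minimize}}\;\; f^*(z-L^*v)+g^*(v)+\langle v\mid r\rangle.\qquad\text{(D)}$$ Let $(a_{1,n})_{n\in\mathbb N}$, $(b_{1,n})_{n\in\mathbb N}$, and $(c_{1,n})_{n\in\mathbb N}$ be absolutely summable sequences in $\mathcal H$, and let $(a_{2,n})_{n\in\mathbb N}$, $(b_{2,n})_{n\in\mathbb N}$, and $(c_{2,n})_{n\in\mathbb N}$ be absolutely summable sequences in $\mathcal G$. Furthermore, let $x_0\in\mathcal H$, let $v_0\in\mathcal G$, let $\varepsilon\in\,]0,1/(\|L\|+1)[$, let $(\gamma_n)_{n\in\mathbb N}$ be a sequence in $[\varepsilon,(1-\varepsilon)/\|L\|]$, and set, for every $n\in\mathbb N$, $$\begin{array}{l} y_{1,n}=x_n-\gamma_n(L^*v_n+a_{1,n})\\ y_{2,n}=v_n+\gamma_n(Lx_n+a_{2,n})\\ p_{1,n}=\operatorname{prox}_{\gamma_nf}(y_{1,n}+\gamma_nz)+b_{1,n}\\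 p_{2,n}=\operatorname{prox}_{\gamma_ng^*}(y_{2,n}-\gamma_nr)+b_{2,n}\\ q_{1,n}=p_{1,n}-\gamma_n(L^*p_{2,n}+c_{1,n})\\ q_{2,n}=p_{2,n}+\gamma_n(Lp_{1,n}+c_{2,n})\\ x_{n+1}=x_n-y_{1,n}+q_{1,n}\\ v_{n+1}=v_n-y_{2,n}+q_{2,n}. \end{array}$$ Then the following hold for some solution $\overline{x}$ to (P) and some solution $\overline{v}$ to (D) such that $z-L^*\overline{v}\in\partial f(\overline{x})$ and $\overline{v}\in\partial g(L\overline{x}-r)$. (i) $x_n-p_{1,n}\to 0$ and $v_n-p_{2,n}\to 0$. (ii) $x_n\rightharpoonup\overline{x}$, $p_{1,n}\rightharpoonup\overline{x}$, $v_n\rightharpoonup\overline{v}$, and $p_{2,n}\rightharpoonup\overline{v}$. (iii) Suppose that $f$ is uniformly convex at $\overline{x}$. Then $x_n\to\overline{x}$ and $p_{1,n}\to\overline{x}$. (iv) Suppose that $g^*$ is uniformly convex at $\overline{v}$. Then $v_n\to\overline{v}$ and $p_{2,n}\to\overline{v}$.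
   Context: $\rightharpoonup$ and $\to$ denote weak and strong convergence; a sequence $(a_n)$ is absolutely summable if $\sum_n\|a_n\|<+\infty$. $L^*$ is the adjoint of $L$. $\Gamma_0(\mathcal H)$ is the class of lower semicontinuous convex functions $f\colon\mathcal H\to\,]-\infty,+\infty]$ with $\operatorname{dom}f=\{x\mid f(x)<+\infty\}\neq\varnothing$. The conjugate of $f$ is $f^*\colon u\mapsto\sup_{x\in\mathcal H}(\langle x\mid u\rangle-f(x))$; the subdifferential is $\partial f(x)=\{u\in\mathcal H\mid(\forall y\in\mathcal H)\ \langle y-x\mid u\rangle+f(x)\leq f(y)\}$; $\operatorname{prox}_fx$ is the unique minimizer of $f+\|x-\cdot\|^2/2$. The range of a set-valued operator $M$ is $\operatorname{ran}M=\{u\mid(\exists x)\ u\in Mx\}$, and $\partial f+L^*\circ(\partial g)\circ(L\cdot-r)$ is the operator $x\mapsto\partial f(x)+L^*(\partial g(Lx-r))$. A function $\varphi\in\Gamma_0(\mathcal H)$ is uniformly convex at $x\in\operatorname{dom}\varphi$ if there exists an increasing function $\phi\colon[0,+\infty[\to[0,+\infty]$ that vanishes only at $0$ such that, for every $y\in\operatorname{dom}\varphi$ and every $\alpha\in\,]0,1[$, $\varphi(\alpha x+(1-\alpha)y)+\alpha(1-\alpha)\phi(\|x-y\|)\leq\alpha\varphi(x)+(1-\alpha)\varphi(y)$. *)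

(* Defs.v *)
From HB Require Import structures.
From mathcomp Require Import all_boot all_order all_algebra.
From mathcomp Require Import all_classical all_reals all_analysis.

Set Implicit Arguments.
Unset Strict Implicit.
Unset Printing Implicit Defensive.

Import Order.TTheory GRing.Theory Num.Theory.
Import numFieldNormedType.Exports.

Local Open Scope classical_set_scope.
Local Open Scope ring_scope.

(* A real Hilbert space: a complete normed module whose norm is induced by an
   inner product. *)
HB.mixin Record CompleteNormedModule_hasInner (R : realType) V
    of CompleteNormedModule R V := {
  inner : {dot V for idfun};
  innervv : forall x : V, inner x x = `|x| ^+ 2
}.

#[short(type="hilbertType")]
HB.structure Definition Hilbert (R : realType) :=
  {V of CompleteNormedModule R V & CompleteNormedModule_hasInner R V}.

Notation "''[' u , v ]" := (inner u%R v%R) : ring_scope.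

Section operators.
Context {R : realType} {H G : hilbertType R}.
Implicit Types (L : H -> G).

Definition bounded_operator L := exists M : R, forall x, `|L x| <= M * `|x|.

Definition opnorm L : R := sup [set `|L x| | x in [set x | `|x| <= 1]].

(* For L linear and bounded, the Riesz representation theorem makes the set
   below a singleton. *)
Definition adjoint L (v : G) : H :=
  xget 0 [set u | forall x, '[L x, v] = '[x, u]].

End operators.

Section sequences.
Context {R : realType} {H : hilbertType R}.

Definition absolutely_summable (a : nat -> H) : Prop :=
  (\sum_(0 <= n <oo) (`|a n|)%:E < +oo)%E.

Definition weak_cvg (x : nat -> H) (l : H) : Prop :=
  forall u : H, '[x n, u] @[n --> \oo] --> ('[l, u] : R).

End sequences.

Section set_valued.
Context {T U : Type}.

Definition ran (M : T -> set U) : set U := [set u | exists x, M x u].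

End set_valued.

Section convex_analysis.
Context {R : realType} {H : hilbertType R}.
Implicit Types (f : H -> \bar R).

Local Open Scope ereal_scope.

Definition edom f : set H := [set x | f x < +oo].

Definition convex_efun f : Prop :=
  forall (x y : H) (a : R), (0 < a < 1)%R ->
    f (a *: x + (1 - a) *: y)%R <= a%:E * f x + (1 - a)%:E * f y.

Definition Gamma0 f : Prop :=
  [/\ forall x, -oo < f x, edom f !=set0, convex_efun f
    & lower_semicontinuous f].

Definition conjugate f (u : H) : \bar R :=
  ereal_sup [set ('[x, u])%:E - f x | x in setT].

Definition subdifferential f (x : H) : set H :=
  [set u | forall y, ('[y - x, u])%:E + f x <= f y].

Definition minimizers f : set H := [set x | forall y, f x <= f y].

(* For f in Gamma0, the set of minimizers below is a singleton. *)
Definition prox f (x : H) : H :=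
  xget 0%R (minimizers (fun y => f y + (`|x - y| ^+ 2 / 2)%:E)).

(* "Increasing" has to be understood in the wide sense, as the modulus phi may
   take the value +oo; only its restriction to [0, +oo[ matters. *)
Definition uniformly_convex_at f (x : H) : Prop :=
  edom f x /\
  exists phi : R -> \bar R,
    [/\ forall t : R, (0 <= t)%R -> 0 <= phi t,
        forall s t : R, (0 <= s)%R -> (s <= t)%R -> phi s <= phi t,
        forall t : R, (0 <= t)%R -> (phi t = 0 <-> t = 0%R)
      & forall (y : H) (a : R), edom f y -> (0 < a < 1)%R ->
          f (a *: x + (1 - a) *: y)%R + (a * (1 - a))%:E * phi `|x - y|%R
            <= a%:E * f x + (1 - a)%:E * f y].

End convex_analysis.

(* Main.v *)
Require Import Defs.
From HB Require Import structures.
From mathcomp Require Import all_boot all_order all_algebra.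
From mathcomp Require Import all_classical all_reals all_analysis.
From mathcomp Require Import ring lra.

Set Implicit Arguments.
Unset Strict Implicit.
Unset Printing Implicit Defensive.

Import Order.TTheory GRing.Theory Num.Theory.
Import numFieldNormedType.Exports.

Local Open Scope classical_set_scope.
Local Open Scope ring_scope.

(** The iteration is Tseng's forward-backward-forward method for the optimality
    system, perturbed by summable errors, in the Hilbert sum of the two spaces.
    On pairs [s = (x, v)] let [A s] be the product of the subdifferential of [f]
    at [x], shifted by [- z], and of the subdifferential of the conjugate of [g]
    at [v], shifted by [r], and let [B s = (L^* v, - L x)]. Then [A] is monotone
    with everywhere defined resolvent, [B] is skew with norm at most that of
    [L], and [s] is a zero of [A + B] exactly when [z - L^* v] is a subgradient
    of [f] at [x] and [v] is a subgradient of [g] at [L x - r]; such pairs solve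
    both problems.

    One exact step from [s] computes the resolvent [p] of the step size times
    [A] at [s - gam B s] and moves to [p + gam (B s - B p)]. By [fbf_step], it
    decreases the squared distance to every zero by at least [eps |s - p|^2].
    With summable errors the distances to zeros still converge
    ([quasi_fejer_cvg]), so that [s n - p n] tends to zero ([fbf_residual]). A
    weak limit [l] of the iterates along an ultrafilter is then a zero:
    monotonicity is tested against the point given by the resolvent at
    [l - B l], and skewness makes the quadratic terms cancel. Opial's lemma
    ([opial]) turns this into weak convergence of the whole sequence to one zero
    ([fbf_weak_cvg]).

    The sum of the two monotonicity gaps, of the subdifferential of [f] in the
    first component and of that of the conjugate of [g] in the second, also tends
    to zero between [p n] and the limit. Both gaps are nonnegative, so each of
    them tends to zero, and uniform convexity of either function at the limit
    forces strong convergence of its component ([uniformly_convex_cvg]).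

    Completeness enters through the existence of proximal points
    ([prox_exists]), which also yields Riesz representation, hence adjoints and
    weak compactness, and the inversion of the subdifferential of the conjugate
    ([conjugate_subdifferential_inv]). The assumption on [z] provides
    subgradients of [f] and [g], and these give the minorants that the existence
    of proximal points requires. *)

(** * Inner products *)

Section inner_product.
Context {R : realType} {H : hilbertType R}.
Implicit Types (x y z : H) (a : R).

Lemma innerC x y : '[x, y] = '[y, x].
Proof. by rewrite hermC/= expr0 mul1r. Qed.

Lemma innerDl x y z : '[x + y, z] = '[x, z] + '[y, z].
Proof. exact: linearDl. Qed.

Lemma innerDr x y z : '[z, x + y] = '[z, x] + '[z, y].
Proof. exact: linearDr. Qed.

Lemma innerNl x z : '[- x, z] = - '[x, z].
Proof. exact: linearNl. Qed.

Lemma innerNr x z : '[z, - x] = - '[z, x].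
Proof. exact: linearNr. Qed.

Lemma innerZl a x z : '[a *: x, z] = a * '[x, z].
Proof. exact: linearZl_LR. Qed.

Lemma innerZr a x z : '[z, a *: x] = a * '[z, x].
Proof. exact: linearZr_LR. Qed.

Definition innerE := (innerDl, innerDr, innerNl, innerNr, innerZl, innerZr).

Lemma inner0l z : '[0, z] = 0 :> R.
Proof. exact: linear0l. Qed.

Lemma inner0r z : '[z, 0] = 0 :> R.
Proof. exact: linear0r. Qed.

Lemma sqr_normD x y : `|x + y| ^+ 2 = `|x| ^+ 2 + 2 * '[x, y] + `|y| ^+ 2.
Proof. by rewrite -!innervv !innerE (innerC y x); ring. Qed.

Lemma sqr_normB x y : `|x - y| ^+ 2 = `|x| ^+ 2 - 2 * '[x, y] + `|y| ^+ 2.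
Proof. by rewrite -!innervv !innerE (innerC y x); ring. Qed.

Lemma cauchy_schwarz x y : `|'[x, y]| <= `|x| * `|y|.
Proof.
wlog xy0 : x / 0 <= '[x, y].
  move=> th; have [/th//|xy0] := leP 0 '[x, y].
  by have := th (- x); rewrite innerNl !normrN; apply; lra.
rewrite ger0_norm//.
have [->|x0] := eqVneq x 0; first by rewrite inner0l normr0 mul0r.
have [->|y0] := eqVneq y 0; first by rewrite inner0r normr0 mulr0.
have nx : 0 < `|x| by rewrite normr_gt0.
have ny : 0 < `|y| by rewrite normr_gt0.
have := sqr_ge0 `| `|y| *: x - `|x| *: y |.
rewrite sqr_normB !innerE !normrZ !normr_id => h.
by rewrite -(ler_pM2l (mulr_gt0 nx ny)); lra.
Qed.

(** Testing against every vector turns an identity between vectors into an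
    identity in the field of scalars, where [ring] and [field] decide it. *)
Lemma inner_ext x y : (forall z, '[x, z] = '[y, z]) -> x = y.
Proof.
move=> xy; apply/eqP; rewrite -subr_eq0 -normr_eq0 -sqrf_eq0 -innervv.
by rewrite innerDl innerNl xy subrr.
Qed.

Lemma inner_le x y : '[x, y] <= `|x| * `|y|.
Proof. exact: le_trans (ler_norm _) (cauchy_schwarz x y). Qed.

End inner_product.

(** * The Hilbert sum of two Hilbert spaces *)

Section product_hilbert.
Context {R : realType} (H G : hilbertType R).

(** A copy of the product type: the product itself carries the maximum norm,
    which in general no inner product induces. *)
Definition hprod : Type := (H * G)%type.

HB.instance Definition _ := GRing.Lmodule.on hprod.

Definition hprod_inner (s t : hprod) : R := '[s.1, t.1] + '[s.2, t.2].

Definition hprod_norm (s : hprod) : R :=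
  Num.sqrt (`|s.1| ^+ 2 + `|s.2| ^+ 2).

Lemma hprod_normE s : hprod_norm s ^+ 2 = `|s.1| ^+ 2 + `|s.2| ^+ 2.
Proof. by rewrite sqr_sqrtr// addr_ge0. Qed.

Lemma hprod_norm_ge0 s : 0 <= hprod_norm s.
Proof. exact: sqrtr_ge0. Qed.

Lemma hprod_ler_normD s t :
  hprod_norm (s + t) <= hprod_norm s + hprod_norm t.
Proof.
have [S0 T0] := (hprod_norm_ge0 s, hprod_norm_ge0 t).
have [ES ET] := (hprod_normE s, hprod_normE t).
rewrite -(@ler_pXn2r _ 2) ?nnegrE ?addr_ge0 ?hprod_norm_ge0//.
rewrite hprod_normE/= !sqr_normD.
have le1 := inner_le s.1 t.1; have le2 := inner_le s.2 t.2.
suff : `|s.1| * `|t.1| + `|s.2| * `|t.2| <= hprod_norm s * hprod_norm t by nra.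
rewrite -(@ler_pXn2r _ 2) ?nnegrE ?addr_ge0 ?mulr_ge0//.
rewrite exprMn ES ET.
have := sqr_ge0 (`|s.1| * `|t.2| - `|s.2| * `|t.1|); nra.
Qed.

Lemma hprod_normrZ (a : R) s : hprod_norm (a *: s) = `|a| * hprod_norm s.
Proof.
rewrite /hprod_norm/= !normrZ !exprMn -mulrDr sqrtrM ?sqr_ge0//.
by rewrite sqrtr_sqr normr_id.
Qed.

Lemma hprod_normr0_eq0 s : hprod_norm s = 0 -> s = 0.
Proof.
move=> s0; have := hprod_normE s; rewrite s0 expr0n/= => /esym/eqP.
rewrite paddr_eq0 ?sqr_ge0// !sqrf_eq0 !normr_eq0 => /andP[/eqP s1 /eqP s2].
by rewrite [s]surjective_pairing s1 s2.
Qed.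

HB.instance Definition _ := Lmodule_isNormed.Build R hprod
  hprod_ler_normD hprod_normrZ hprod_normr0_eq0.

Lemma sqr_hprod_norm (s : hprod) : `|s| ^+ 2 = `|s.1| ^+ 2 + `|s.2| ^+ 2.
Proof. exact: hprod_normE. Qed.

Lemma ler_hprod_norm1 (s : hprod) : `|s.1| <= `|s|.
Proof.
by rewrite -(@ler_pXn2r _ 2) ?nnegrE// sqr_hprod_norm lerDl sqr_ge0.
Qed.

Lemma ler_hprod_norm2 (s : hprod) : `|s.2| <= `|s|.
Proof.
by rewrite -(@ler_pXn2r _ 2) ?nnegrE// sqr_hprod_norm lerDr sqr_ge0.
Qed.

Lemma ler_hprod_normD (s : hprod) : `|s| <= `|s.1| + `|s.2|.
Proof.
rewrite -(@ler_pXn2r _ 2) ?nnegrE ?addr_ge0// sqr_hprod_norm.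
have := normr_ge0 s.1; have := normr_ge0 s.2; nra.
Qed.

Lemma hprod_cvg T (F : set_system T) {FF : Filter F} (s : T -> hprod)
    (l : hprod) :
  (s t).1 @[t --> F] --> l.1 -> (s t).2 @[t --> F] --> l.2 -> s @ F --> l.
Proof.
move=> /cvgrPdist_lt s1 /cvgrPdist_lt s2; apply/cvgrPdist_lt => e e0.
near=> t; apply: le_lt_trans (ler_hprod_normD _) _.
rewrite (splitr e) ltrD//.
- by near: t; apply: s1; rewrite divr_gt0.
- by near: t; apply: s2; rewrite divr_gt0.
Unshelve. all: by end_near. Qed.

Lemma hprod_cvg1 T (F : set_system T) {FF : Filter F} (s : T -> hprod)
    (l : hprod) : s @ F --> l -> (s t).1 @[t --> F] --> l.1.
Proof.
move=> /cvgrPdist_lt sl; apply/cvgrPdist_lt => e e0; near=> t.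
by apply: le_lt_trans (ler_hprod_norm1 (l - s t)) _; near: t; exact: sl.
Unshelve. all: by end_near. Qed.

Lemma hprod_cvg2 T (F : set_system T) {FF : Filter F} (s : T -> hprod)
    (l : hprod) : s @ F --> l -> (s t).2 @[t --> F] --> l.2.
Proof.
move=> /cvgrPdist_lt sl; apply/cvgrPdist_lt => e e0; near=> t.
by apply: le_lt_trans (ler_hprod_norm2 (l - s t)) _; near: t; exact: sl.
Unshelve. all: by end_near. Qed.

Lemma hprod_complete (F : set_system hprod) :
  ProperFilter F -> cauchy F -> cvg F.
Proof.
move=> FF /cauchyP Fc.
have c1 : cvg (@fst H G @ F).
  apply: cauchy_cvg; apply/cauchyP => e e0; have [s Fs] := Fc e e0.
  exists s.1; apply: (@filterS _ F) Fs => t; rewrite -!ball_normE/=.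
  exact: le_lt_trans (ler_hprod_norm1 (s - t)).
have c2 : cvg (@snd H G @ F).
  apply: cauchy_cvg; apply/cauchyP => e e0; have [s Fs] := Fc e e0.
  exists s.2; apply: (@filterS _ F) Fs => t; rewrite -!ball_normE/=.
  exact: le_lt_trans (ler_hprod_norm2 (s - t)).
apply/cvg_ex; exists (lim (@fst H G @ F), lim (@snd H G @ F)).
exact: hprod_cvg.
Qed.

HB.instance Definition _ := Uniform_isComplete.Build hprod hprod_complete.

Lemma hprod_inner_bilinear : bilinear_for
  (GRing.Scale.Law.clone _ _ *%R _)
  (GRing.Scale.Law.clone _ _ (idfun \; *%R) _) hprod_inner.
Proof.
split=> [u a x y|u a x y] /=; rewrite /hprod_inner/= !innerE; ring.
Qed.

HB.instance Definition _ := bilinear_isBilinear.Build R hprod hprod R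
  _ _ hprod_inner hprod_inner_bilinear.

Lemma hprod_inner_hermitian (s t : hprod) :
  hprod_inner s t = (-1) ^+ false * idfun (hprod_inner t s).
Proof. by rewrite expr0 mul1r /hprod_inner innerC (innerC s.2). Qed.

HB.instance Definition _ := isHermitianSesquilinear.Build R hprod false idfun
  hprod_inner hprod_inner_hermitian.

Lemma hprod_inner_norm (s : hprod) : hprod_inner s s = `|s| ^+ 2.
Proof. by rewrite sqr_hprod_norm /hprod_inner !innervv. Qed.

Lemma hprod_inner_gt0 (s : hprod) : s != 0 -> 0 < hprod_inner s s.
Proof. by move=> s0; rewrite hprod_inner_norm exprn_gt0// normr_gt0. Qed.

HB.instance Definition _ :=
  isDotProduct.Build R hprod hprod_inner hprod_inner_gt0.

HB.instance Definition _ :=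
  CompleteNormedModule_hasInner.Build R hprod hprod_inner_norm.

End product_hilbert.

Section product_hilbert_theory.
Context {R : realType} {H G : hilbertType R}.
Implicit Types s t : hprod H G.

Lemma hprod_innerE s t : '[s, t] = '[s.1, t.1] + '[s.2, t.2].
Proof. by []. Qed.

Lemma weak_cvg_hprod1 (s : nat -> hprod H G) (l : hprod H G) :
  weak_cvg s l -> weak_cvg (fun n => (s n).1) l.1.
Proof.
move=> sl u; have := sl (u, 0); rewrite hprod_innerE/= inner0r addr0.
by under eq_fun do rewrite hprod_innerE/= inner0r addr0.
Qed.

Lemma weak_cvg_hprod2 (s : nat -> hprod H G) (l : hprod H G) :
  weak_cvg s l -> weak_cvg (fun n => (s n).2) l.2.
Proof.
move=> sl u; have := sl (0, u); rewrite hprod_innerE/= inner0r add0r.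
by under eq_fun do rewrite hprod_innerE/= inner0r add0r.
Qed.

End product_hilbert_theory.

(** * Existence of proximal points *)

Section proximity_operator.
Context {R : realType} {H : hilbertType R}.
Implicit Types (f : H -> \bar R) (x y p u : H).

(** The objective is strongly convex: by the parallelogram identity,
    almost-minimizers are close to each other, so that they form a Cauchy
    filter, whose limit is a minimizer by lower semicontinuity. The minorant,
    decreasing at most linearly, is dominated by the quadratic term and makes
    the infimum finite. *)
Lemma prox_exists f x :
  (forall y, -oo < f y)%E -> edom f !=set0 -> convex_efun f ->
  lower_semicontinuous f ->
  (exists c M : R, forall y, ((c - M * `|y|)%:E <= f y)%E) ->
  minimizers (fun y => f y + (`|x - y| ^+ 2 / 2)%:E)%E !=set0.
Proof.
move=> fNy [y0 fy0] fcvx flsc [c [M fge]].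
pose q y : R := `|x - y| ^+ 2 / 2.
pose A (t : R) := [set y | f y + (q y)%:E <= t%:E]%E.
pose S := [set t | A t !=set0].
have S0 : S !=set0.
  exists (fine (f y0) + q y0), y0; rewrite /A/=.
  by rewrite EFinD fineK// fin_numE gt_eqF//= lt_eqF.
have Slb : lbound S (c - M * `|x| - M ^+ 2 / 2).
  move=> t [y]; rewrite /A/= => Ay.
  have : ((c - M * `|y| + q y)%:E <= t%:E)%E.
    by apply: le_trans Ay; rewrite EFinD leeD2r.
  rewrite lee_fin; apply: le_trans.
  rewrite /q.
  have [M0|M0] := leP 0 M.
    have : `|y| <= `|x - y| + `|x|.
      by rewrite (distrC x) -{1}(subrK x y) ler_normD.
    have := sqr_ge0 (`|x - y| - M); nra.
  have : `|x| <= `|x - y| + `|y| by rewrite -{1}(subrK y x) ler_normD.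
  have := sqr_ge0 (`|x - y| + M); nra.
pose m := inf S.
have mlb t y : A t y -> m <= t.
  by move=> Aty; apply: ge_inf; [exists (c - M * `|x| - M ^+ 2 / 2)|exists y].
have A0 (d : R) : 0 < d -> A (m + d) !=set0.
  move=> d0; have [|t [y Aty] tm] := @inf_adherent _ S d d0.
    by split=> //; exists (c - M * `|x| - M ^+ 2 / 2).
  by exists y; apply: le_trans Aty _; rewrite lee_fin ltW.
(* The midpoint of two points of a sublevel set lies in a lower sublevel set. *)
have Adist t y y' : A t y -> A t y' -> `|y - y'| ^+ 2 <= 8 * (t - m).
  rewrite /A/= -!leeBrDr// => Ay Ay'.
  have half : 0 < (1 / 2 : R) < 1 by lra.
  have : A (t - `|y - y'| ^+ 2 / 8) (1 / 2 *: y + (1 - 1 / 2) *: y').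
    rewrite /A/= -leeBrDr//; apply: le_trans (fcvx _ _ _ half) _.
    have h : ((1 / 2)%:E * f y + (1 - 1 / 2)%:E * f y' <=
        (1 / 2)%:E * (t%:E - (q y)%:E) + (1 - 1 / 2)%:E * (t%:E - (q y')%:E))%E.
      by rewrite leeD// lee_wpmul2l// lee_fin; lra.
    apply: le_trans h _; rewrite -!EFinB -!EFinM -EFinD lee_fin /q.
    rewrite -!innervv !innerE (innerC y x) (innerC y' x) (innerC y' y).
    lra.
  by move/mlb; lra.
pose F := filter_from [set d : R | 0 < d] (fun d => A (m + d)).
have FF : ProperFilter F.
  apply: filter_from_proper; last by move=> d; exact: A0.
  apply: filter_from_filter; first by exists 1 => /=.
  move=> d d' /= d0 d'0; exists (Num.min d d'); first by rewrite /= lt_min d0.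
  move=> y Ay; split; apply: le_trans Ay _;
    by rewrite lee_fin lerD2l ge_min lexx ?orbT.
have Fc : cauchy F.
  apply/cauchyP => e e0; pose d := e ^+ 2 / 16.
  have d0 : 0 < d by rewrite divr_gt0 ?exprn_gt0.
  have [y Ay] := A0 _ d0; exists y, d => // y' Ay'; rewrite -ball_normE/=.
  rewrite -(@ltr_pXn2r _ 2) ?nnegrE ?(ltW e0)//.
  apply: le_lt_trans (Adist _ _ _ Ay Ay') _; rewrite /d.
  have : 0 < e ^+ 2 by rewrite exprn_gt0.
  lra.
have [p Fp] : exists p, F --> p by apply/cvg_ex; exact: cauchy_cvg.
have pm : (f p + (q p)%:E <= m%:E)%E.
  rewrite leNgt; apply/negP => mp.
  have [a am fpa] : exists2 a, m - q p < a & (a%:E < f p)%E.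
    move: mp; case: (f p) (fNy p) => // [fp _|_ _].
      rewrite -EFinD lte_fin => mp; exists ((m - q p + fp) / 2).
        by rewrite ltr_pdivlMr//; lra.
      by rewrite lte_fin ltr_pdivrMr//; lra.
    by exists (m - q p + 1); rewrite ?ltry//; lra.
  have [V pV fV] := flsc _ _ fpa.
  pose d := (a - (m - q p)) / 3.
  have d0 : 0 < d by rewrite divr_gt0// subr_gt0.
  have qF : q y @[y --> F] --> q p.
    rewrite /q; apply: cvgMr_tmp; rewrite expr2.
    under eq_fun do rewrite expr2.
    have nF : `|x - y| @[y --> F] --> `|x - p|.
      by apply: cvg_norm; apply: cvgB Fp; exact: cvg_cst.
    exact: cvgM.
  have [y [[Vy Ay] qy]] : (V `&` A (m + d) `&` [set y | q p - d < q y]) !=set0.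
    apply: (@filter_ex _ F); apply: filterI; first apply: filterI.
    - exact: Fp.
    - by exists d.
    - by apply: (cvgr_gt _ qF); lra.
  have : ((a + q y)%:E <= (m + d)%:E)%E.
    by apply: le_trans Ay; rewrite EFinD leeD2r// ltW// fV.
  rewrite lee_fin; move: qy; rewrite /= /d; lra.
exists p => y; apply: le_trans pm _.
case fyE : (f y) (fNy y) => [t| |] // _; last by rewrite addye// leey.
by rewrite -EFinD lee_fin; apply: (mlb _ y); rewrite /A/= fyE.
Qed.

End proximity_operator.

(** * Subdifferentials and proximity operators *)

Section subdifferential_theory.
Context {R : realType} {H : hilbertType R}.
Implicit Types (f : H -> \bar R) (x y p u v w : H).

Lemma subdifferential_fin f x u :
  Gamma0 f -> subdifferential f x u -> f x \is a fin_num.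
Proof.
move=> [fNy [y0 fy0] _ _] /(_ y0) fxu; rewrite fin_numE gt_eqF//=.
apply/eqP => fx; move: fxu; rewrite fx addey// leye_eq => /eqP fy0y.
by move: fy0; rewrite /edom/= fy0y.
Qed.

Lemma subdifferential_monotone f x y u v : Gamma0 f ->
  subdifferential f x u -> subdifferential f y v -> 0 <= '[x - y, u - v].
Proof.
move=> hf fxu fyv.
have := fxu y; have := fyv x.
rewrite -(fineK (subdifferential_fin hf fxu)).
rewrite -(fineK (subdifferential_fin hf fyv)).
rewrite -!EFinD !lee_fin !innerE; lra.
Qed.

(** The minorant required by [prox_exists], from a subgradient at one point. *)
Lemma subdifferential_cone_minorant f x u :
  Gamma0 f -> subdifferential f x u ->
  exists c M : R, forall y, ((c - M * `|y|)%:E <= f y)%E.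
Proof.
move=> hf fxu; exists (fine (f x) - '[x, u]), `|u| => y.
apply: le_trans (fxu y); rewrite -(fineK (subdifferential_fin hf fxu)).
rewrite -EFinD lee_fin fineK ?(subdifferential_fin hf fxu)// !innerE.
have := cauchy_schwarz y u; rewrite ler_norml => /andP[+ _]; lra.
Qed.

Lemma minimizers_subdifferential f x p : Gamma0 f ->
  minimizers (fun y => f y + (`|x - y| ^+ 2 / 2)%:E)%E p ->
  subdifferential f p (x - p).
Proof.
move=> [fNy [y0 fy0] fcvx _] pmin y.
have : (f p < +oo)%E.
  have : (f p + (`|x - p| ^+ 2 / 2)%:E < +oo)%E.
    by apply: le_lt_trans (pmin y0) _; rewrite lte_add_pinfty ?ltry.
  by case: (f p) (fNy p).
case fpE : (f p) (fNy p) => [a| |] // _ _.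
case fyE : (f y) (fNy y) => [b| |] // _; last by rewrite leey.
rewrite -EFinD lee_fin leNgt; apply/negP => ba.
(* Moving from p towards y by a fraction t changes the objective by at most
   t^2 N - t d, which would be negative for small t. *)
pose N := `|y - p| ^+ 2 / 2; pose d := '[y - p, x - p] + a - b.
have N0 : 0 <= N by rewrite divr_ge0.
have d0 : 0 < d by rewrite /d; lra.
suff tN t : 0 < t < 1 -> d <= t * N.
  have h : 0 < d / (2 * (d + N)) < 1.
    by rewrite divr_gt0 ?mulr_gt0//= ?ltr_pdivrMr ?mulr_gt0//; lra.
  have := tN _ h; rewrite mulrAC ler_pdivlMr ?mulr_gt0//; nra.
move=> t01; have := le_trans (pmin _) (leeD2r _ (fcvx y p t t01)).
rewrite fpE fyE -!EFinM -!EFinD lee_fin.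
move=> h; case/andP: t01 => t0 _; rewrite -(ler_pM2l t0); move: h.
rewrite /d /N -!innervv !innerE (innerC p x) (innerC y x) (innerC y p).
lra.
Qed.

Lemma prox_subdifferential f x0 u0 x : Gamma0 f -> subdifferential f x0 u0 ->
  subdifferential f (prox f x) (x - prox f x).
Proof.
move=> hf f0; apply: minimizers_subdifferential => //.
case: (hf) => fNy fdom fcvx flsc.
rewrite /prox; apply: xgetPex; apply: prox_exists => //.
exact: subdifferential_cone_minorant hf f0.
Qed.

Lemma prox_nonexpansive f x0 u0 x y : Gamma0 f -> subdifferential f x0 u0 ->
  `|prox f x - prox f y| <= `|x - y|.
Proof.
move=> hf f0; set p := prox f x; set q := prox f y.
have := subdifferential_monotone hf (prox_subdifferential x hf f0)
  (prox_subdifferential y hf f0).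
rewrite -/p -/q; have -> : x - p - (y - q) = (x - y) - (p - q).
  by apply: inner_ext => w; rewrite !innerE; ring.
rewrite innerDr innerNr innervv subr_ge0 => pq.
have [->|pq0] := eqVneq (p - q) 0; first by rewrite normr0.
have n0 : 0 < `|p - q| by rewrite normr_gt0.
rewrite -(ler_pM2l n0) -expr2; apply: le_trans pq _; exact: inner_le.
Qed.

Lemma Gamma0Z (c : R) f : 0 < c -> Gamma0 f -> Gamma0 (fun y => c%:E * f y)%E.
Proof.
move=> c0 [fNy [y0 fy0] fcvx flsc]; split.
- move=> y; case: (f y) (fNy y) => [r| |]// _; first by rewrite -EFinM ltNyr.
  by rewrite gt0_muley ?lte_fin.
- exists y0; move: fy0; rewrite /edom/=; case: (f y0) (fNy y0) => [r| |]// _ _.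
  by rewrite -EFinM ltry.
- move=> x y a a01; apply: le_trans (lee_wpmul2l _ (fcvx x y a a01)) _.
    by rewrite lee_fin ltW.
  have [a0 a1] : 0 < a /\ 0 < 1 - a by case/andP: a01 => *; split; lra.
  have NyM (b : R) z : 0 < b -> (-oo < b%:E * f z)%E.
    move=> b0; case: (f z) (fNy z) => [r| |]// _; first by rewrite -EFinM ltNyr.
    by rewrite gt0_muley ?lte_fin.
  rewrite muleDr//; last first.
    by have := NyM _ x a0; have := NyM _ y a1; case: (_ * _)%E; case: (_ * _)%E.
  by rewrite !muleA ![(c%:E * _)%E]muleC.
- have E (a : R) z : (a%:E < c%:E * f z)%E = ((c^-1 * a)%:E < f z)%E.
    by rewrite EFinM lte_pdivrMl.
  move=> x a; rewrite E => /flsc[V Vx fV].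
  by exists V => // y /fV; rewrite E.
Qed.

Lemma subdifferentialZ (c : R) f x u : 0 < c ->
  subdifferential (fun y => c%:E * f y)%E x u <->
  subdifferential f x (c^-1 *: u).
Proof.
move=> c0; have E y : (('[y - x, u])%:E + c%:E * f x <= c%:E * f y)%E =
    (('[y - x, c^-1 *: u])%:E + f x <= f y)%E.
  rewrite -[RHS](lee_pmul2l (x := c%:E))// muleDr ?fin_num_adde_defr//.
  by rewrite -EFinM innerZr mulVKf ?gt_eqF.
by split=> h y; [rewrite -E; exact: h|rewrite E; exact: h].
Qed.

Lemma proxZ_subdifferential (c : R) f x0 u0 x : 0 < c ->
  Gamma0 f -> subdifferential f x0 u0 ->
  let p := prox (fun y => c%:E * f y)%E x in
  subdifferential f p (c^-1 *: (x - p)).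
Proof.
move=> c0 hf f0 p; apply/subdifferentialZ => //.
apply: (@prox_subdifferential _ x0 (c *: u0)); first exact: Gamma0Z.
by apply/subdifferentialZ => //; rewrite scalerK// gt_eqF.
Qed.

Lemma proxZ_perturbation (c : R) f x0 u0 x y b : 0 < c ->
  Gamma0 f -> subdifferential f x0 u0 ->
  `|prox (fun w => c%:E * f w)%E x + b - prox (fun w => c%:E * f w)%E y|
    <= `|x - y| + `|b|.
Proof.
move=> c0 hf f0; rewrite addrAC; apply: le_trans (ler_normD _ _) _.
rewrite lerD2r; apply: (@prox_nonexpansive _ x0 (c *: u0)).
  exact: Gamma0Z.
by apply/subdifferentialZ => //; rewrite scalerK// gt_eqF.
Qed.

End subdifferential_theory.

(** * Riesz representation and adjoints *)

Section riesz_representation.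
Context {R : realType} {H : hilbertType R}.

Lemma lipschitz_at_cvg (phi : H -> R) (x : H) (M : R) :
  (forall y, `|phi x - phi y| <= M * `|x - y|) -> phi y @[y --> x] --> phi x.
Proof.
move=> phiM; apply/cvgrPdist_lt => e e0.
have M0 : 0 < `|M| + 1 by rewrite ltr_wpDl.
have d0 : 0 < e / (`|M| + 1) by rewrite divr_gt0.
near=> y; apply: le_lt_trans (phiM y) _.
have : `|x - y| < e / (`|M| + 1) by near: y; exact: cvgr_dist_lt.
rewrite ltr_pdivlMr//; apply: le_lt_trans.
by rewrite mulrC ler_wpM2l// ler_wpDr// ler_norm.
Unshelve. all: by end_near. Qed.

Lemma EFin_lower_semicontinuous (phi : H -> R) :
  (forall x, phi y @[y --> x] --> phi x) ->
  lower_semicontinuous (fun x => (phi x)%:E).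
Proof.
move=> phic x a; rewrite lte_fin => ax.
exists [set y | a < phi y]; first exact: (cvgr_gt _ (phic x)).
by move=> y /=; rewrite lte_fin.
Qed.

(** The representing vector is the proximal point of the opposite functional at
    the origin: its subgradient inequality bounds a linear functional by another
    one, and the two then coincide. *)
Lemma riesz (l : H -> R) (M : R) :
  linear_for *%R l -> (forall x, `|l x| <= M * `|x|) ->
  exists u, forall x, l x = '[x, u].
Proof.
move=> ll lM.
have lB x y : l (x - y) = l x - l y.
  by rewrite addrC -scaleN1r ll mulN1r addrC.
have lD x y : l (x + y) = l x + l y by rewrite -{1}[x]scale1r ll mul1r.
have lZ a x : l (a *: x) = a * l x.
  by rewrite -[a *: x]addr0 ll -(subrr x) lB subrr addr0.
pose f x := (- l x)%:E.
have fG : Gamma0 f.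
  split.
  - by move=> y; rewrite ltNyr.
  - by exists 0; rewrite /edom/= /f ltry.
  - by move=> x y a _; rewrite /f lD !lZ -!EFinM -EFinD lee_fin; lra.
  - apply: EFin_lower_semicontinuous => x.
    apply: (@lipschitz_at_cvg _ _ M) => y.
    by rewrite opprK addrC -lB distrC lM.
have [p pmin] : minimizers (fun y => f y + (`|0 - y| ^+ 2 / 2)%:E)%E !=set0.
  case: (fG) => fNy f0 fcvx flsc; apply: prox_exists => //.
  exists 0, M => y; rewrite /f lee_fin sub0r lerN2.
  exact: le_trans (ler_norm _) (lM y).
have := minimizers_subdifferential fG pmin; rewrite sub0r => fp.
have lp h : l h <= '[h, p].
  have := fp (h + p); rewrite addrK innerNr /f lD -EFinD lee_fin; lra.
exists p => x; apply/le_anti; rewrite lp/=.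
have := lp (- x); rewrite innerNl -sub0r lB -{1}(subrr x) lB; lra.
Qed.

End riesz_representation.

Section adjoint_theory.
Context {R : realType} {H G : hilbertType R}.
Variables (L : {linear H -> G}) (hL : bounded_operator L).

Lemma adjointP x v : '[L x, v] = '[x, adjoint L v].
Proof.
have [M LM] := hL.
have [||u uP] := @riesz _ _ (fun y => '[L y, v]) (M * `|v|).
- by move=> a y w; rewrite linearP innerDl innerZl.
- move=> y; apply: le_trans (cauchy_schwarz _ _) _.
  by rewrite mulrAC ler_wpM2r.
- have := @xgetPex _ 0 [set u | forall y, '[L y, v] = '[y, u]].
  by apply; exists u.
Qed.

Lemma opnorm_has_ubound :
  has_ubound [set `|L x| | x in [set x | `|x| <= 1]].
Proof.
have [M LM] := hL; exists `|M| => _ [y /= y1 <-]; apply: le_trans (LM y) _.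
apply: le_trans (ler_wpM2r _ (ler_norm M)) _ => //.
by rewrite -[leRHS]mulr1 ler_wpM2l.
Qed.

Lemma opnorm_ge0 : 0 <= opnorm L.
Proof.
apply: ub_le_sup; first exact: opnorm_has_ubound.
by exists 0; rewrite /= ?linear0 normr0.
Qed.

Lemma opnorm_le x : `|L x| <= opnorm L * `|x|.
Proof.
have [->|x0] := eqVneq x 0; first by rewrite linear0 !normr0 mulr0.
have nx : 0 < `|x| by rewrite normr_gt0.
rewrite -ler_pdivrMr//; apply: ub_le_sup; first exact: opnorm_has_ubound.
exists (`|x|^-1 *: x).
  by rewrite /= normrZ gtr0_norm ?invr_gt0// mulVf ?gt_eqF.
by rewrite linearZ/= normrZ gtr0_norm ?invr_gt0// mulrC.
Qed.

Lemma opnorm_gt0 : (L : H -> G) <> (fun=> 0) -> 0 < opnorm L.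
Proof.
move=> L0; have [x Lx] : exists x, L x != 0.
  apply: contra_notP L0 => /forallNP Lx; apply/funext => x.
  by apply/eqP; apply: contrapT => h; apply: (Lx x); apply/negP.
have x0 : x != 0 by apply: contra_neq Lx => ->; exact: linear0.
have := opnorm_le x; rewrite -ler_pdivrMr ?normr_gt0//; apply: lt_le_trans.
by rewrite divr_gt0 ?normr_gt0.
Qed.

Lemma adjoint_opnorm_le v : `|adjoint L v| <= opnorm L * `|v|.
Proof.
have [->|u0] := eqVneq (adjoint L v) 0.
  by rewrite normr0 mulr_ge0// opnorm_ge0.
have nu : 0 < `|adjoint L v| by rewrite normr_gt0.
rewrite -(ler_pM2r nu) -expr2 -innervv -adjointP.
apply: le_trans (inner_le _ _) _.
by rewrite mulrAC ler_wpM2r// opnorm_le.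
Qed.

Lemma adjointB v w : adjoint L (v - w) = adjoint L v - adjoint L w.
Proof.
apply: inner_ext => x; rewrite innerDl innerNl innerC (innerC (adjoint L v)).
by rewrite (innerC (adjoint L w)) -!adjointP innerDr innerNr.
Qed.

End adjoint_theory.

(** * Conjugation *)

Section conjugation.
Context {R : realType} {H : hilbertType R}.
Implicit Types (f : H -> \bar R) (x y u v w : H).

Lemma fenchel_young f x u : (('[x, u])%:E - f x <= conjugate f u)%E.
Proof. by apply: ereal_sup_ubound; exists x. Qed.

Lemma conjugate_subdifferential f x u : Gamma0 f -> subdifferential f x u ->
  conjugate f u = ('[x, u] - fine (f x))%:E.
Proof.
move=> hf fxu; have fx := subdifferential_fin hf fxu.
apply/le_anti/andP; split; last first.
  by rewrite EFinB fineK// fenchel_young.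
apply: ge_ereal_sup => _ [y _ <-]; have := fxu y; rewrite -(fineK fx).
case: hf => fNy _ _ _; case: (f y) (fNy y) => [r| |]// _.
  by rewrite -EFinB -EFinD !lee_fin !innerE; lra.
by rewrite addeNy leNye.
Qed.

Lemma subdifferential_conjugate f x u : Gamma0 f -> subdifferential f x u ->
  subdifferential (conjugate f) u x.
Proof.
move=> hf fxu v; apply: le_trans (fenchel_young f x v).
rewrite (conjugate_subdifferential hf fxu).
rewrite -(fineK (subdifferential_fin hf fxu)).
rewrite -EFinB -EFinD lee_fin fineK ?(subdifferential_fin hf fxu)//.
by rewrite innerDl innerNl (innerC v) (innerC u); lra.
Qed.

Lemma Gamma0_conjugate f x u : Gamma0 f -> subdifferential f x u ->
  Gamma0 (conjugate f).
Proof.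
move=> hf fxu; have cNy v : (-oo < conjugate f v)%E.
  apply: lt_le_trans (fenchel_young f x v).
  by rewrite -(fineK (subdifferential_fin hf fxu)) -EFinB ltNyr.
split=> //.
- by exists u; rewrite /edom/= (conjugate_subdifferential hf fxu) ltry.
- move=> v w a a01; apply: ge_ereal_sup => _ [y _ <-].
  have [a0 a1] : 0 <= a /\ 0 <= 1 - a by case/andP: a01 => *; split; lra.
  case: hf => fNy _ _ _; case fyE : (f y) (fNy y) => [r| |]// _; last first.
    by rewrite addeNy leNye.
  have -> : (('[y, (a *: v + (1 - a) *: w)%R])%:E - r%:E =
     a%:E * (('[y, v])%:E - r%:E) + (1 - a)%:E * (('[y, w])%:E - r%:E))%E.
    by rewrite -!EFinB -!EFinM -EFinD !innerE; congr EFin; ring.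
  by rewrite leeD// lee_wpmul2l ?lee_fin// -fyE fenchel_young.
- move=> v a av.
  have [y ay] : exists y, (a%:E < ('[y, v])%:E - f y)%E.
    apply: contrapT => /forallNP nay; move: av; apply/negP; rewrite -leNgt.
    by apply: ge_ereal_sup => _ [y _ <-]; rewrite leNgt; apply/negP.
  case: hf => fNy _ _ _; case fyE : (f y) ay (fNy y) => [r| |]// ay _.
  have [||V vV yV] :=
    @EFin_lower_semicontinuous _ _ (fun w => '[y, w] - r) _ v a.
  + move=> w; apply: (@lipschitz_at_cvg _ _ _ _ `|y|) => w'.
    rewrite opprB addrA subrK -innerNr -innerDr.
    exact: cauchy_schwarz.
  + by rewrite EFinB.
  + exists V => // w /yV; rewrite EFinB -fyE => /lt_le_trans; apply.
    exact: fenchel_young.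
Qed.

(** The proximal point [q] of [f] at [x + u] satisfies the desired inclusion with
    [x + u - q], and monotonicity of the subdifferential of the conjugate forces
    [q = x]. *)
Lemma conjugate_subdifferential_inv f x0 u0 x u : Gamma0 f ->
  subdifferential f x0 u0 -> subdifferential (conjugate f) u x ->
  subdifferential f x u.
Proof.
move=> hf f0 cux; set q := prox f (x + u).
have fq : subdifferential f q (x + u - q) := prox_subdifferential _ hf f0.
have cq := subdifferential_conjugate hf fq.
have := subdifferential_monotone (Gamma0_conjugate hf f0) cux cq.
have -> : u - (x + u - q) = - (x - q).
  by rewrite !opprD opprK addrA (addrCA u) subrr addr0.
rewrite innerNl innervv oppr_ge0 => xq.
have {}xq : x = q.
  by apply/eqP; rewrite -subr_eq0 -normr_eq0 -sqrf_eq0 eq_le xq sqr_ge0.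
by move: fq; rewrite -xq (addrC x) addrK.
Qed.

End conjugation.

(** * Uniform convexity *)

Section uniform_convexity.
Context {R : realType} {H : hilbertType R}.
Implicit Types (f : H -> \bar R) (x y u v w : H).

(** Uniform convexity enters the convergence proof through this uniform form of
    strict monotonicity of the subdifferential. It comes from adding the
    convexity inequality at the midpoint, the subgradient inequality of [u]
    there and the subgradient inequality of [w] at [x]. The modulus may be
    infinite, hence the real number [d] below it. *)
Lemma uniformly_convex_monotone f x u (e : R) : Gamma0 f ->
  uniformly_convex_at f x -> subdifferential f x u -> 0 < e ->
  exists2 d : R, 0 < d & forall y w, subdifferential f y w ->
    e <= `|y - x| -> d <= '[y - x, w - u].
Proof.
move=> hf [_ [phi [phi0 phile phieq0 fuc]]] fxu e0.
have [d d0 de] : exists2 d : R, 0 < d & (d%:E <= phi e)%E.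
  have := phi0 e (ltW e0); have := phieq0 e (ltW e0).
  case: (phi e) => [r rE|_ _|_]//; last by exists 1; rewrite ?leey.
  rewrite lee_fin le_eqVlt => /orP[/eqP r0|r0]; last by exists r.
  by have := rE.1 (congr1 EFin (esym r0)) => ee; rewrite ee ltxx in e0.
exists (d / 2); first by rewrite divr_gt0.
move=> y w fyw exy.
have [fx fy] := (subdifferential_fin hf fxu, subdifferential_fin hf fyw).
have half : 0 < (1 / 2 : R) < 1 by lra.
have fy_dom : edom f y by rewrite /edom/= ltey_eq fy.
have dphi : (d%:E <= phi `|x - y|%R)%E.
  by apply: le_trans de _; apply: phile; rewrite ?(ltW e0)// distrC.
have := fuc y (1 / 2) fy_dom half.
pose m := (1 / 2 : R) *: x + (1 - 1 / 2 : R) *: y.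
rewrite -/m; have := fyw x; have := fxu m.
have : ((1 / 2 * (1 - 1 / 2))%:E * d%:E <=
    (1 / 2 * (1 - 1 / 2))%:E * phi `|x - y|%R)%E.
  by rewrite lee_wpmul2l// lee_fin; lra.
rewrite -(fineK fx) -(fineK fy) -!EFinM -!EFinD.
move=> h1 h2 h3 h4.
have := le_trans (leeD h2 h1) h4; rewrite -EFinD lee_fin.
move: h3; rewrite lee_fin /m !innerE; lra.
Qed.

Lemma uniformly_convex_cvg f x u (y w : nat -> H) : Gamma0 f ->
  uniformly_convex_at f x -> subdifferential f x u ->
  (forall n, subdifferential f (y n) (w n)) ->
  '[y n - x, w n - u] @[n --> \oo] --> (0 : R) -> y @ \oo --> x.
Proof.
move=> hf fuc fxu fyw yw0; apply/cvgrPdist_lt => e e0.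
have [d d0 dP] := uniformly_convex_monotone hf fuc fxu e0.
near=> n; rewrite ltNge; apply/negP; rewrite distrC => /(dP _ _ (fyw n)).
by apply/negP; rewrite -ltNge; near: n; exact: (cvgr_lt _ yw0).
Unshelve. all: by end_near. Qed.

End uniform_convexity.

(** * Weak convergence *)

Section weak_convergence.
Context {R : realType} {H : hilbertType R}.
Implicit Types (x y z : H).

(** If some neighborhood of the limit were avoided on a set meeting every member
    of the filter, an ultrafilter containing that set would contradict the
    hypothesis. *)
Lemma cvg_ultra_sub T (F : set_system T) (phi : T -> R) (l : R) : Filter F ->
  (forall U, UltraFilter U -> F `<=` U -> phi t @[t --> U] --> l) ->
  phi t @[t --> F] --> l.
Proof.
move=> FF FU; apply/cvgrPdist_lt => e e0; apply: contrapT => nF.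
pose B := [set t | `|l - phi t| < e].
pose F' := filter_from F (fun A => A `&` ~` B).
have F'P : ProperFilter F'.
  apply: filter_from_proper.
    apply: filter_from_filter; first by exists setT; exact: filterT.
    move=> A A' FA FA'; exists (A `&` A'); first exact: filterI.
    by move=> t [[At A't] Bt].
  move=> A FA; apply: contrapT => /forallNP h; apply: nF.
  by apply: filterS FA => t At; apply: contrapT => Bt; apply: (h t).
have [U [UU F'U]] := ultraFilterLemma F'P.
have /(FU U UU)/cvgrPdist_lt/(_ e e0) UB : F `<=` U.
  by move=> A FA; apply: F'U; exists A => // t [].
have UnB : U (~` B).
  by apply: F'U; exists setT; [exact: filterT|move=> t []].
by have [t [Bt]] := filter_ex (filterI UB UnB).
Qed.

Lemma ultra_bounded_cvg T (U : set_system T) (phi : T -> R) (M : R) :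
  UltraFilter U -> (forall t, `|phi t| <= M) -> cvg (phi t @[t --> U]).
Proof.
move=> UU phiM.
have [|l [_ lcl]] := @segment_compact R (- M) M (phi @ U) _.
  by apply: (@filterE _ U) => t /=; rewrite in_itv/= -ler_norml.
apply/cvg_ex; exists l => B lB /=.
have [//|UnB] := in_ultra_setVsetC (phi @^-1` B) UU.
by have [r [nBr]] := lcl (~` B) B UnB lB.
Qed.

(** Weak compactness of balls: the limits along an ultrafilter of the inner
    products with fixed vectors exist all at once and form a bounded linear
    functional, to which Riesz representation applies. *)
Lemma ultra_weak_limit T (U : set_system T) (x : T -> H) (M : R) :
  UltraFilter U -> (forall t, `|x t| <= M) ->
  exists l, forall u, '[x t, u] @[t --> U] --> '[l, u].
Proof.
move=> UU xM.
have cv u : cvg ('[x t, u] @[t --> U]).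
  apply: (@ultra_bounded_cvg _ _ _ (M * `|u|)) => t.
  by apply: le_trans (cauchy_schwarz _ _) _; rewrite ler_wpM2r.
have [||l lE] := @riesz _ _ (fun u => lim ('[x t, u] @[t --> U])) M.
- move=> a u v /=.
  apply: cvg_lim => //; under eq_fun do rewrite innerDr innerZr.
  by apply: cvgD; [apply: cvgMl_tmp; exact: cv|exact: cv].
- move=> u.
  have lcvg : `|'[x t, u]| @[t --> U] --> `|lim ('[x t, u] @[t --> U])|.
    by apply: cvg_norm; exact: cv.
  rewrite -(cvg_lim _ lcvg)//; apply: limr_le.
    by apply/cvg_ex; eexists; exact: lcvg.
  apply: filterE => t; apply: le_trans (cauchy_schwarz _ _) _.
  by rewrite ler_wpM2r.
by exists l => u; rewrite (innerC l) -lE; exact: cv.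
Qed.

(** Opial's lemma, with limits along ultrafilters in the role of weak cluster
    points. *)
Lemma opial (Z : set H) (x : nat -> H) :
  (forall z, Z z -> cvgn (fun n => `|x n - z|)) -> Z !=set0 ->
  (forall U l, UltraFilter U -> \oo `<=` U ->
    (forall u, '[x n, u] @[n --> U] --> ('[l, u] : R)) -> Z l) ->
  exists2 l, Z l & weak_cvg x l.
Proof.
move=> xcvg [z0 Zz0] ZU.
have [M xM] : exists M, forall n, `|x n| <= M.
  have [M M0] : exists M, forall n, `|x n - z0| <= M.
    have /cvg_seq_bounded[M [Mr MP]] := xcvg z0 Zz0; exists (M + 1) => n.
    by rewrite -normr_id; apply: (MP (M + 1)) => //; rewrite ltrDl.
  exists (M + `|z0|) => n; rewrite -{1}(subrK z0 (x n)).
  by apply: le_trans (ler_normD _ _) _; rewrite lerD2r.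
have [U0 [UU0 oU0]] := ultraFilterLemma (eventually_filter).
have [l xl] := ultra_weak_limit UU0 xM.
have Zl := ZU U0 l UU0 oU0 xl; exists l => // u.
apply: cvg_ultra_sub => U UU oU.
have [l' xl'] := ultra_weak_limit UU xM.
have Zl' := ZU U l' UU oU xl'.
suff -> : l = l' by exact: xl'.
(* The inner products with l - l' converge, since they are an affine function
   of the difference of the squared distances to l and l'. *)
pose D n := '[x n, l - l'].
have Dcv : cvgn D.
  have -> : D = (fun n => 2^-1 * (`|x n - l'| * `|x n - l'|
      - `|x n - l| * `|x n - l| + (`|l| ^+ 2 - `|l'| ^+ 2))).
    by apply/funext => n; rewrite /D -!expr2 !sqr_normB !innerE; field.
  apply: is_cvgMl_tmp; apply: is_cvgD; last exact: is_cvg_cst.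
  by apply: is_cvgB; apply: is_cvgM; exact: xcvg.
have DU0 : D @ U0 --> '[l, l - l'] := xl (l - l').
have DU : D @ U --> '[l', l - l'] := xl' (l - l').
have E : '[l, l - l'] = '[l', l - l'] :> R.
  have DoU0 : D @ U0 --> limn D by move=> B /Dcv; exact: oU0.
  have DoU : D @ U --> limn D by move=> B /Dcv; exact: oU.
  rewrite -(cvg_lim _ DU0)// -(cvg_lim _ DU)//.
  by rewrite (cvg_lim _ DoU0)// (cvg_lim _ DoU).
apply/eqP; rewrite -subr_eq0 -normr_eq0 -sqrf_eq0 -innervv.
by rewrite innerDl innerNl E subrr.
Qed.

End weak_convergence.

(** * Quasi-Fejer sequences and null sequences *)

Section quasi_fejer.
Context {R : realType}.

(** Subtracting the partial sums of the errors makes the sequence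
    nonincreasing. *)
Lemma quasi_fejer_cvg (a e : nat -> R) :
  (forall n, 0 <= a n) -> (forall n, a n.+1 <= a n + e n) ->
  cvgn (series e) -> cvgn a.
Proof.
move=> a0 ae ecv.
have [M eM] : exists M, forall n, series e n <= M.
  have [M [_ MP]] := cvg_seq_bounded ecv; exists (M + 1) => n.
  apply: le_trans (ler_norm _) _; apply: (MP (M + 1)) => //; rewrite ltrDl//.
have : cvgn (a - series e).
  apply: nonincreasing_is_cvgn.
    apply/nonincreasing_seqP => n; rewrite !fctE seriesSr.
    by have := ae n; lra.
  exists (- M) => _ [n _ <-]; rewrite !fctE.
  by have := a0 n; have := eM n; lra.
by move=> /is_cvgD/(_ ecv); rewrite subrK.
Qed.

End quasi_fejer.

Section null_sequences.
Context {R : realType} {H : hilbertType R}.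

Lemma cvg_close (x y : nat -> H) (l : H) :
  (x n - y n @[n --> \oo] --> (0 : H)) -> y @ \oo --> l -> x @ \oo --> l.
Proof.
move=> xy yl; rewrite -[l]add0r (_ : x = (fun n => x n - y n + y n)).
  exact: cvgD.
by apply/funext => n; rewrite subrK.
Qed.

Lemma cvg_inner0 T (F : set_system T) (x y : T -> H) (M : R) : Filter F ->
  (forall t, `|x t| <= M) -> y @ F --> (0 : H) ->
  '[x t, y t] @[t --> F] --> (0 : R).
Proof.
move=> FF xM /cvgr0Pnorm_lt y0; apply/cvgr0Pnorm_lt => e e0.
have M0 : 0 < `|M| + 1 by rewrite ltr_wpDl.
have d0 : 0 < e / (`|M| + 1) by rewrite divr_gt0.
near=> t; apply: le_lt_trans (cauchy_schwarz _ _) _.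
have : `|y t| < e / (`|M| + 1) by near: t; exact: y0.
rewrite ltr_pdivlMr//; apply: le_lt_trans.
rewrite mulrC ler_wpM2l// (le_trans (xM t))//.
by rewrite ler_wpDr// ler_norm.
Unshelve. all: by end_near. Qed.

Lemma weak_cvg_add0 (x y : nat -> H) (l : H) : weak_cvg x l ->
  (x n - y n @[n --> \oo] --> (0 : H)) -> weak_cvg y l.
Proof.
move=> xl xy u.
have -> : (fun n => '[y n, u]) = (fun n => '[x n, u] - '[u, x n - y n]).
  by apply/funext => n; rewrite (innerC u) !innerE; ring.
rewrite -['[l, u]]subr0; apply: cvgB; first exact: xl.
by apply: (@cvg_inner0 _ _ (fun=> u) _ `|u|).
Qed.

End null_sequences.

(** * Forward-backward-forward splitting with a skew operator *)

Section monotone_operators.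
Context {R : realType} {H : hilbertType R}.

Definition monotone_operator (A : H -> set H) : Prop :=
  forall x y u v, A x u -> A y v -> 0 <= '[x - y, u - v].

(** For a monotone operator this is maximal monotonicity, by Minty's theorem. *)
Definition everywhere_resolvent (A : H -> set H) : Prop :=
  forall s, exists p, A p (s - p).

End monotone_operators.

Section forward_backward_forward.
Context {R : realType} {K : hilbertType R}.
Variables (A : K -> set K) (B : K -> K) (beta eps : R).
Hypothesis Amon : monotone_operator A.
Hypothesis Ares : everywhere_resolvent A.
Hypothesis Bskew : forall x y, '[B x, y] = - '[x, B y].
Hypothesis B_le : forall x, `|B x| <= beta * `|x|.
Hypothesis beta0 : 0 <= beta.
Hypothesis eps01 : 0 < eps < 1.

Let BB x y : B (x - y) = B x - B y.
Proof.
by apply: inner_ext => z; rewrite innerDl innerNl !Bskew !innerE; ring.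
Qed.

Let Binner0 x : '[x, B x] = 0 :> R.
Proof. by have := Bskew x x; rewrite innerC; lra. Qed.

(** Tseng's inequality. Monotonicity of [A], together with the skewness of [B],
    controls the cross term of the expanded square, and the bound on the step
    size leaves a fraction [eps] of [|s - p|^2]. *)
Lemma fbf_step (s p z : K) (gam : R) : 0 < gam -> gam * beta <= 1 - eps ->
  A p (gam^-1 *: (s - gam *: B s - p)) -> A z (- B z) ->
  `|p + gam *: (B s - B p) - z| ^+ 2 <= `|s - z| ^+ 2 - eps * `|s - p| ^+ 2.
Proof.
move=> gam0 gambeta Ap Az; case/andP: eps01 => eps0 eps1.
pose d := s - p; pose w := p - z.
have mono : gam * '[w, B d] <= '[w, d].
  have := Amon Ap Az; rewrite -(pmulr_rge0 _ gam0) opprK => mono.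
  rewrite -innerZr scalerDr scalerA mulfV ?gt_eqF// scale1r -/w in mono.
  move: mono.
  have -> : s - gam *: B s - p + gam *: B z = d - gam *: (B d + B w).
    by apply: inner_ext => y; rewrite /d /w 2!BB !innerE; ring.
  by rewrite innerDr innerNr innerZr innerDr Binner0; lra.
have -> : s - z = w + d.
  by apply: inner_ext => y; rewrite /d /w !innerE; ring.
have -> : p + gam *: (B s - B p) - z = w + gam *: B d.
  by rewrite /d BB /w addrAC.
rewrite -/d; clearbody d w.
rewrite !sqr_normD innerZr normrZ exprMn gtr0_norm//.
have gb0 : 0 <= gam * beta by rewrite mulr_ge0// ltW.
have : gam ^+ 2 * `|B d| ^+ 2 <= (1 - eps) ^+ 2 * `|d| ^+ 2.
  rewrite -!exprMn ler_pXn2r ?nnegrE ?mulr_ge0 ?(ltW gam0)//; last lra.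
  apply: le_trans (ler_wpM2l (ltW gam0) (B_le d)) _.
  by rewrite mulrA ler_wpM2r.
have : (1 - eps) ^+ 2 * `|d| ^+ 2 <= (1 - eps) * `|d| ^+ 2.
  by rewrite ler_wpM2r ?sqr_ge0// expr2 ler_piMr; lra.
by lra.
Qed.

Variables (s p : nat -> K) (gam e : nat -> R).
Hypothesis gamP : forall n, eps <= gam n /\ gam n * beta <= 1 - eps.
Let u n := (gam n)^-1 *: (s n - gam n *: B (s n) - p n).
Hypothesis Apu : forall n, A (p n) (u n).
Hypothesis sE :
  forall n, `|s n.+1 - (p n + gam n *: (B (s n) - B (p n)))| <= e n.
Hypothesis ecvg : cvgn (series e).
Hypothesis Z0 : exists z, A z (- B z).

Let t n := p n + gam n *: (B (s n) - B (p n)).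

Let gam0 n : 0 < gam n.
Proof.
by have [+ _] := gamP n; case/andP: eps01 => e0 _; apply: lt_le_trans.
Qed.

Let step z n : A z (- B z) ->
  `|t n - z| ^+ 2 <= `|s n - z| ^+ 2 - eps * `|s n - p n| ^+ 2.
Proof. by move=> Az; apply: fbf_step => //; have [] := gamP n. Qed.

Let step_le z n : A z (- B z) -> `|t n - z| <= `|s n - z|.
Proof.
move=> Az; rewrite -(@ler_pXn2r _ 2) ?nnegrE//.
apply: le_trans (step n Az) _; rewrite gerBl mulr_ge0 ?sqr_ge0//.
by case/andP: eps01 => /ltW.
Qed.

Let err_le z n : `|s n.+1 - z| <= `|t n - z| + e n.
Proof.
have -> : s n.+1 - z = (t n - z) + (s n.+1 - t n).
  by apply: inner_ext => y; rewrite !innerE; ring.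
by apply: le_trans (ler_normD _ _) _; rewrite lerD2l.
Qed.

Let dist_cvg z : A z (- B z) -> cvgn (fun n => `|s n - z|).
Proof.
move=> Az; apply: (quasi_fejer_cvg _ _ ecvg) => // n.
by apply: le_trans (err_le z n) _; rewrite lerD2r step_le.
Qed.

(** The distances of [s n] and of the exact update [t n] to a zero have the same
    limit, and the decrease in [fbf_step] is bounded by the difference of their
    squares. *)
Lemma fbf_residual : s n - p n @[n --> \oo] --> (0 : K).
Proof.
have [z Az] := Z0; have /cvg_ex[l al] := dist_cvg Az.
have e0 := cvg_series_cvg_0 ecvg.
have tl : `|t n - z| @[n --> \oo] --> l.
  apply: (squeeze_cvgr _ _ al).
    apply: nearW => n; rewrite step_le// andbT.
    have := err_le z n; rewrite -lerBlDr; exact.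
  rewrite -[l]subr0; apply: cvgB e0.
  by rewrite (cvg_shiftS (fun n => `|s n - z|)).
have gap : `|s n - z| * `|s n - z| - `|t n - z| * `|t n - z| @[n --> \oo] --> 0.
  by rewrite -(subrr (l * l)); apply: cvgB; apply: cvgM.
case/andP: eps01 => eps0 _.
apply/cvgr0Pnorm_lt => d d0.
have c0 : 0 < eps * d ^+ 2 by rewrite mulr_gt0 ?exprn_gt0.
near=> n; rewrite -(@ltr_pXn2r _ 2) ?nnegrE ?(ltW d0)// -(ltr_pM2l eps0).
have : `|s n - z| * `|s n - z| - `|t n - z| * `|t n - z| < eps * d ^+ 2.
  by near: n; apply: cvgr_lt c0.
by apply: le_lt_trans; have := step n Az; rewrite !expr2; lra.
Unshelve. all: by end_near. Qed.

(** [w n] is a value at [p n] of the sum of [A] and [B], and it tends to zero in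
    norm. *)
Let w n := (gam n)^-1 *: (s n - p n) - B (s n - p n).

Let uE n : u n = w n - B (p n).
Proof.
apply: inner_ext => y; rewrite /u /w BB !innerE; field.
by rewrite gt_eqF.
Qed.

Let w0 : w @ \oo --> (0 : K).
Proof.
case/andP: eps01 => eps0 _.
have c0 : 0 < eps^-1 + beta by rewrite ltr_wpDr// invr_gt0.
apply/cvgr0Pnorm_lt => d d0; near=> n.
have sp : `|s n - p n| < d / (eps^-1 + beta).
  by near: n; apply: (cvgr0_norm_lt _ fbf_residual); rewrite divr_gt0.
move: sp; rewrite ltr_pdivlMr//; apply: le_lt_trans.
apply: le_trans (ler_normB _ _) _; rewrite mulrC mulrDl lerD// normrZ.
rewrite ler_wpM2r// gtr0_norm ?invr_gt0// lef_pV2 ?posrE//.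
by have [] := gamP n.
Unshelve. all: by end_near. Qed.

Let p_bounded : exists M, forall n, `|p n| <= M.
Proof.
have [z Az] := Z0.
have [M1 [_ M1P]] := cvg_seq_bounded (dist_cvg Az).
have : cvgn (fun n => s n - p n) by apply/cvg_ex; exists 0; exact: fbf_residual.
move=> /cvg_seq_bounded[M2 [_ M2P]].
exists (`|z| + (M1 + 1) + (M2 + 1)) => n.
have h1 : `|s n - z| <= M1 + 1.
  by rewrite -normr_id; apply: M1P => //; rewrite ltrDl.
have h2 : `|s n - p n| <= M2 + 1 by apply: M2P => //; rewrite ltrDl.
have -> : p n = z + (s n - z) - (s n - p n).
  by apply: inner_ext => y; rewrite !innerE; ring.
apply: le_trans (ler_normB _ _) _; apply: lerD => //.
by apply: le_trans (ler_normD _ _) _; rewrite lerD2l.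
Qed.

Let inner_w0 z : '[p n - z, w n] @[n --> \oo] --> (0 : R).
Proof.
have [M pM] := p_bounded.
apply: (@cvg_inner0 _ _ _ _ (fun n => p n - z) _ (M + `|z|)) => // n.
by apply: le_trans (ler_normB _ _) _; rewrite lerD2r.
Qed.

(** Monotonicity between [p n] and the point [q] given by the resolvent of [A] at
    [l - B l] passes to the limit, because skewness makes the expression affine
    in [p n] up to a null term. The limit reads [0 <= - |l - q|^2]. *)
Let ultra_limit_zero U l : UltraFilter U -> \oo `<=` U ->
  (forall y, '[s n, y] @[n --> U] --> ('[l, y] : R)) -> A l (- B l).
Proof.
move=> UU oU sl.
have pl y : '[p n, y] @[n --> U] --> ('[l, y] : R).
  have -> : (fun n => '[p n, y]) = (fun n => '[s n, y] - '[y, s n - p n]).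
    by apply/funext => n; rewrite (innerC y) !innerE; ring.
  rewrite -['[l, y]]subr0; apply: cvgB; first exact: sl.
  apply: (@cvg_inner0 _ _ _ _ (fun=> y) _ `|y|) => // C C0.
  exact/oU/fbf_residual.
have [q Aq] := Ares (l - B l).
have : '[p n - q, u n - (l - B l - q)] @[n --> U] --> - `|l - q| ^+ 2.
  have -> : (fun n => '[p n - q, u n - (l - B l - q)]) =
      (fun n => '[p n - q, w n] - '[p n, B q] - '[p n, l - B l - q]
                + '[q, l - B l - q]).
    apply/funext => n; rewrite uE.
    have := Bskew q (p n); have := Binner0 (p n).
    rewrite (innerC (B q)) !innerE; lra.
  have -> : - `|l - q| ^+ 2 =
      0 - '[l, B q] - '[l, l - B l - q] + '[q, l - B l - q].
    rewrite -innervv; have := Bskew q l; have := Binner0 l.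
    rewrite (innerC (B q)) !innerE (innerC q l); lra.
  apply: cvgD; last exact: cvg_cst.
  apply: cvgB (pl _); apply: cvgB (pl _).
  by move=> C C0; exact/oU/inner_w0.
move=> lim_lq; have {lim_lq} : 0 <= - `|l - q| ^+ 2.
  rewrite -(cvg_lim _ lim_lq)//; apply: limr_ge.
    by apply/cvg_ex; eexists; exact: lim_lq.
  by apply: filterE => n; exact: Amon.
rewrite oppr_ge0 => lq; have {}lq : l = q.
  by apply/eqP; rewrite -subr_eq0 -normr_eq0 -sqrf_eq0 eq_le lq sqr_ge0.
by move: Aq; rewrite -lq addrAC subrr sub0r.
Qed.

(** The last assertion is the source of strong convergence: the inner product is
    the monotonicity gap of [A] between [p n] and the weak limit. *)
Lemma fbf_weak_cvg : exists z, [/\ A z (- B z), weak_cvg s z, weak_cvg p z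
  & '[p n - z, u n + B z] @[n --> \oo] --> (0 : R)].
Proof.
have [|||z Az sz] := @opial _ _ [set z | A z (- B z)] s.
- exact: dist_cvg.
- exact: Z0.
- exact: ultra_limit_zero.
exists z; split=> //; first exact: weak_cvg_add0 sz fbf_residual.
have -> : (fun n => '[p n - z, u n + B z]) = (fun n => '[p n - z, w n]).
  apply/funext => n; have -> : u n + B z = w n - B (p n - z).
    by apply: inner_ext => y; rewrite uE BB !innerE; ring.
  by rewrite innerDr innerNr Binner0 subr0.
exact: inner_w0.
Qed.

End forward_backward_forward.

(** * The optimality system *)

Section kuhn_tucker.
Context {R : realType} {H G : hilbertType R}.
Variables (f : H -> \bar R) (g : G -> \bar R) (L : {linear H -> G}).
Variables (z : H) (r : G).
Hypotheses (hf : Gamma0 f) (hg : Gamma0 g) (hL : bounded_operator L).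

(** Adding the two subgradient inequalities, the terms that couple [x] and [v]
    through [L] cancel. *)
Lemma kuhn_tucker_primal x v :
  subdifferential f x (z - adjoint L v) -> subdifferential g (L x - r) v ->
  minimizers (fun x' => f x' + g (L x' - r)%R - ('[x', z])%:E)%E x.
Proof.
move=> fx gx y; have := fx y; have := gx (L y - r).
rewrite -(fineK (subdifferential_fin hf fx)).
rewrite -(fineK (subdifferential_fin hg gx)).
case: hf => fNy _ _ _; case: hg => gNy _ _ _.
case: (f y) (fNy y) => [a| |]// _; last first.
  move=> _ _; case: (g (L y - r)) (gNy (L y - r)) => [b| |]// _.
    by rewrite /= leey.
  by rewrite /= leey.
case: (g (L y - r)) (gNy (L y - r)) => [b| |]// _; last first.
  by move=> _ _; rewrite leey.
rewrite -!EFinB -!EFinD !lee_fin.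
have -> : L y - r - (L x - r) = L (y - x).
  by rewrite opprB addrA subrK -linearB.
rewrite (adjointP hL) !innerE; lra.
Qed.

Lemma kuhn_tucker_dual x v :
  subdifferential f x (z - adjoint L v) -> subdifferential g (L x - r) v ->
  minimizers (fun v' => conjugate f (z - adjoint L v')%R + conjugate g v'
                        + ('[v', r])%:E)%E v.
Proof.
move=> fx gx w.
have := subdifferential_conjugate hf fx (z - adjoint L w).
have := subdifferential_conjugate hg gx w.
rewrite (conjugate_subdifferential hf fx) (conjugate_subdifferential hg gx).
have [fNy _ _ _] := Gamma0_conjugate hf fx.
have [gNy _ _ _] := Gamma0_conjugate hg gx.
case: (conjugate f _) (fNy (z - adjoint L w)) => [a| |]// _; last first.
  by move=> _ _; case: (conjugate g w) (gNy w) => [b| |]// _; rewrite /= leey.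
case: (conjugate g w) (gNy w) => [b| |]// _; last by move=> _ _; rewrite leey.
rewrite -!EFinD !lee_fin.
have -> : z - adjoint L w - (z - adjoint L v) = - adjoint L (w - v).
  by rewrite adjointB// !opprB addrC addrA subrK.
rewrite innerNl (innerC (adjoint _ _)) -(adjointP hL) !innerE -(adjointP hL).
rewrite (innerC w (L x)) (innerC v (L x)) (innerC r); lra.
Qed.

(** The inclusions [z - L^* v] in the subdifferential of [f] at [x] and [L x - r]
    in that of the conjugate of [g] at [v] say that zero is in the sum of this
    operator and of [kt_skew] at [(x, v)]. *)
Definition kt_operator (s : hprod H G) : set (hprod H G) :=
  [set u | subdifferential f s.1 (u.1 + z) /\
           subdifferential (conjugate g) s.2 (u.2 - r)].

Definition kt_skew (s : hprod H G) : hprod H G := (adjoint L s.2, - L s.1).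

Variables (x0 : H) (u0 : H) (y0 w0 : G).
Hypotheses (f0 : subdifferential f x0 u0) (g0 : subdifferential g y0 w0).

Lemma kt_operator_monotone : monotone_operator kt_operator.
Proof.
move=> s t u v [su1 su2] [tv1 tv2]; rewrite hprod_innerE/= addr_ge0//.
  have := subdifferential_monotone hf su1 tv1.
  by rewrite opprD addrACA subrr addr0.
have := subdifferential_monotone (Gamma0_conjugate hg g0) su2 tv2.
by rewrite opprB addrA subrK.
Qed.

Lemma kt_operator_resolvent : everywhere_resolvent kt_operator.
Proof.
move=> s; have hcg := Gamma0_conjugate hg g0.
exists (prox f (s.1 + z), prox (conjugate g) (s.2 - r)); split=> /=.
  by rewrite addrAC; exact: prox_subdifferential hf f0.
rewrite addrAC; apply: prox_subdifferential hcg _.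
exact: subdifferential_conjugate hg g0.
Qed.

Lemma kt_skewP s t : '[kt_skew s, t] = - '[s, kt_skew t].
Proof.
rewrite !hprod_innerE/= (innerC (adjoint L s.2)) -!(adjointP hL).
by rewrite innerNl innerNr (innerC s.2); ring.
Qed.

Lemma kt_skew_le s : `|kt_skew s| <= opnorm L * `|s|.
Proof.
rewrite -(@ler_pXn2r _ 2) ?nnegrE ?mulr_ge0 ?opnorm_ge0//.
rewrite exprMn !sqr_hprod_norm/= normrN mulrDr addrC -!exprMn.
rewrite lerD// ler_pXn2r ?nnegrE ?mulr_ge0 ?opnorm_ge0//.
  exact: opnorm_le.
exact: adjoint_opnorm_le.
Qed.

Lemma kt_zeroP s : kt_operator s (- kt_skew s) <->
  subdifferential f s.1 (z - adjoint L s.2) /\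
  subdifferential g (L s.1 - r) s.2.
Proof.
rewrite /kt_operator/= opprK addrC; split=> -[fs gs]; split=> //.
  exact: conjugate_subdifferential_inv hg g0 gs.
exact: subdifferential_conjugate hg gs.
Qed.

End kuhn_tucker.

(** * Convergence of the primal-dual algorithm *)

Section absolute_summability.
Context {R : realType} {H : hilbertType R}.

Lemma absolutely_summable_cvg (a : nat -> H) :
  absolutely_summable a -> cvgn (series (fun n => `|a n|)).
Proof.
move=> aoo; apply: nondecreasing_is_cvgn.
  by apply/nondecreasing_seqP => n; rewrite seriesSr lerDl.
exists (fine (\sum_(0 <= n <oo) (`|a n|)%:E)%E) => _ [n _ <-].
have h : (\sum_(0 <= k < n) (`|a k|)%:E <= \sum_(0 <= k <oo) (`|a k|)%:E)%E.
  by apply: nneseries_lim_ge => k _ _; rewrite lee_fin.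
rewrite -lee_fin fineK; first by rewrite sumEFin in h.
rewrite ge0_fin_numE//; exact: nneseries_ge0.
Qed.

End absolute_summability.

Section perturbed_step.
Context {R : realType} {H G : hilbertType R}.
Variables (L : {linear H -> G}) (hL : bounded_operator L).

(** The difference is linear in the errors: in the first component it is
    [c a1 + (p1 - P1) - c L^* (p2 - P2) - c c1], and similarly in the second. *)
Lemma kt_step_error (c Gam d1 d2 : R) (x y1 q1 a1 c1 p1 P1 : H)
    (v y2 q2 a2 c2 p2 P2 : G) :
  0 < c -> c <= Gam -> c * opnorm L <= 1 ->
  y1 = x - c *: (adjoint L v + a1) -> y2 = v + c *: (L x + a2) ->
  q1 = p1 - c *: (adjoint L p2 + c1) -> q2 = p2 + c *: (L p1 + c2) ->
  `|p1 - P1| <= d1 -> `|p2 - P2| <= d2 ->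
  `|((x - y1 + q1, v - y2 + q2) : hprod H G)
    - ((P1, P2) + c *: (kt_skew L (x, v) - kt_skew L (P1, P2)))|
    <= Gam * (`|a1| + `|a2| + (`|c1| + `|c2|)) + 2 * (d1 + d2).
Proof.
move=> c0 cGam cL -> -> -> -> pP1 pP2.
have E1 : x - (x - c *: (adjoint L v + a1)) + (p1 - c *: (adjoint L p2 + c1))
    - (P1 + c *: (adjoint L v - adjoint L P2)) =
    c *: a1 + (p1 - P1) - c *: adjoint L (p2 - P2) - c *: c1.
  rewrite adjointB//.
  by apply: inner_ext => t; rewrite !innerE; ring.
have E2 : v - (v + c *: (L x + a2)) + (p2 + c *: (L p1 + c2))
    - (P2 + c *: (- L x - - L P1)) =
    - (c *: a2) + (p2 - P2) + c *: L (p1 - P1) + c *: c2.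
  rewrite (linearB L).
  by apply: inner_ext => t; rewrite !innerE; ring.
apply: le_trans (ler_hprod_normD _) _; rewrite /= E1 E2.
have cLM (b : R) : 0 <= b -> c * (opnorm L * b) <= b.
  by move=> b0; rewrite mulrA -[leRHS]mul1r ler_wpM2r.
have L1 : c * `|L (p1 - P1)| <= d1.
  apply: le_trans pP1; apply: le_trans (cLM _ (normr_ge0 _)).
  by rewrite ler_wpM2l ?(ltW c0)// opnorm_le.
have L2 : c * `|adjoint L (p2 - P2)| <= d2.
  apply: le_trans pP2; apply: le_trans (cLM _ (normr_ge0 _)).
  by rewrite ler_wpM2l ?(ltW c0)// adjoint_opnorm_le.
have cM (V : normedModType R) (w : V) : `|c *: w| <= Gam * `|w|.
  by rewrite normrZ gtr0_norm// ler_wpM2r.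
have T1 : `|c *: a1 + (p1 - P1) - c *: adjoint L (p2 - P2) - c *: c1|
    <= `|c *: a1| + `|p1 - P1| + `|c *: adjoint L (p2 - P2)| + `|c *: c1|.
  do 2![apply: le_trans (ler_normB _ _) _; rewrite lerD2r].
  exact: ler_normD.
have T2 : `|- (c *: a2) + (p2 - P2) + c *: L (p1 - P1) + c *: c2|
    <= `|c *: a2| + `|p2 - P2| + `|c *: L (p1 - P1)| + `|c *: c2|.
  do 2![apply: le_trans (ler_normD _ _) _; rewrite lerD2r].
  by rewrite -(normrN (c *: a2)) ler_normD.
have := cM _ a1; have := cM _ a2; have := cM _ c1; have := cM _ c2.
move: L1 L2 T1 T2; rewrite !(normrZ _ (L _)) !(normrZ _ (adjoint L _)).
rewrite (gtr0_norm c0); lra.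
Qed.

End perturbed_step.

Theorem proposition4p2 (R : realType) (H G : hilbertType R)
    (f : H -> \bar R) (hf : Gamma0 f)
    (g : G -> \bar R) (hg : Gamma0 g)
    (L : {linear H -> G}) (hL : bounded_operator L)
    (z : H) (r : G)
    (hL0 : (L : H -> G) <> (fun=> 0))
    (hz : ran (fun x : H =>
                 [set u + adjoint L w | u in subdifferential f x
                                      & w in subdifferential g (L x - r)]) z)
    (a1 b1 c1 : nat -> H)
    (ha1 : absolutely_summable a1) (hb1 : absolutely_summable b1)
    (hc1 : absolutely_summable c1)
    (a2 b2 c2 : nat -> G)
    (ha2 : absolutely_summable a2) (hb2 : absolutely_summable b2)
    (hc2 : absolutely_summable c2)
    (x0 : H) (v0 : G)
    (eps : R) (heps : 0 < eps < 1 / (opnorm L + 1))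
    (gam : nat -> R)
    (hgam : forall n, eps <= gam n <= (1 - eps) / opnorm L)
    (x y1 p1 q1 : nat -> H) (v y2 p2 q2 : nat -> G)
    (hx0 : x 0%N = x0) (hv0 : v 0%N = v0)
    (hy1 : forall n, y1 n = x n - gam n *: (adjoint L (v n) + a1 n))
    (hy2 : forall n, y2 n = v n + gam n *: (L (x n) + a2 n))
    (hp1 : forall n,
       p1 n = prox (fun w => (gam n)%:E * f w)%E (y1 n + gam n *: z) + b1 n)
    (hp2 : forall n,
       p2 n = prox (fun w => (gam n)%:E * conjugate g w)%E
                (y2 n - gam n *: r) + b2 n)
    (hq1 : forall n, q1 n = p1 n - gam n *: (adjoint L (p2 n) + c1 n))
    (hq2 : forall n, q2 n = p2 n + gam n *: (L (p1 n) + c2 n))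
    (hx : forall n, x n.+1 = x n - y1 n + q1 n)
    (hv : forall n, v n.+1 = v n - y2 n + q2 n) :
  exists (xbar : H) (vbar : G),
    [/\ minimizers (fun x' : H => f x' + g (L x' - r)%R - ('[x', z])%:E)%E xbar,
        minimizers (fun v' : G => conjugate f (z - adjoint L v')%R
                                  + conjugate g v' + ('[v', r])%:E)%E vbar,
        subdifferential f xbar (z - adjoint L vbar)
      & subdifferential g (L xbar - r) vbar]
    /\
    [/\ (x n - p1 n @[n --> \oo] --> (0 : H)) /\
        (v n - p2 n @[n --> \oo] --> (0 : G)),
        [/\ weak_cvg x xbar, weak_cvg p1 xbar,
            weak_cvg v vbar & weak_cvg p2 vbar],
        uniformly_convex_at f xbar ->
          (x n @[n --> \oo] --> xbar) /\ (p1 n @[n --> \oo] --> xbar)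
      & uniformly_convex_at (conjugate g) vbar ->
          (v n @[n --> \oo] --> vbar) /\ (p2 n @[n --> \oo] --> vbar)].
Proof.
case: hz => xs [us fus [ws gws zE]].
have us_E : us = z - adjoint L ws by rewrite -zE addrK.
have hcg := Gamma0_conjugate hg gws.
have cgs := subdifferential_conjugate hg gws.
have beta0 : 0 < opnorm L := opnorm_gt0 hL hL0.
have [eps0 eps1] : 0 < eps /\ eps < 1.
  case/andP: heps => e0 e1; split=> //; apply: lt_trans e1 _.
  by rewrite ltr_pdivrMr; lra.
pose Gam := (1 - eps) / opnorm L.
have gamP n : eps <= gam n /\ gam n * opnorm L <= 1 - eps.
  by have /andP[? +] := hgam n; rewrite ler_pdivlMr.
have gam_le n : gam n <= Gam by have /andP[] := hgam n.
have gam0 n : 0 < gam n by apply: lt_le_trans eps0 _; have [] := gamP n.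
(* The proximal points of the exact step from (x n, v n). *)
pose P1 n := prox (fun w => (gam n)%:E * f w)%E
  (x n - gam n *: adjoint L (v n) + gam n *: z).
pose P2 n := prox (fun w => (gam n)%:E * conjugate g w)%E
  (v n + gam n *: L (x n) - gam n *: r).
pose s n : hprod H G := (x n, v n).
pose p n : hprod H G := (P1 n, P2 n).
pose B : hprod H G -> hprod H G := kt_skew L.
pose u n := (gam n)^-1 *: (s n - gam n *: B (s n) - p n).
have u1E n : (u n).1 + z = (gam n)^-1 *:
    (x n - gam n *: adjoint L (v n) + gam n *: z - P1 n).
  apply: inner_ext => t; rewrite /= !innerE; field.
  by rewrite gt_eqF.
have u2E n : (u n).2 - r = (gam n)^-1 *:
    (v n + gam n *: L (x n) - gam n *: r - P2 n).
  apply: inner_ext => t; rewrite /= !innerE; field.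
  by rewrite gt_eqF.
have Apu n : kt_operator f g z r (p n) (u n).
  split; rewrite ?u1E ?u2E; first exact: proxZ_subdifferential hf fus.
  exact: proxZ_subdifferential hcg cgs.
(* The errors of step n displace the next iterate by at most C * N n. *)
pose N n := `|a1 n| + `|b1 n| + `|c1 n| + (`|a2 n| + `|b2 n| + `|c2 n|).
pose C := 3 * Gam + 2.
have C0 : 0 <= Gam by rewrite (le_trans (ltW (gam0 0%N))).
have d1 n : `|p1 n - P1 n| <= Gam * `|a1 n| + `|b1 n|.
  rewrite hp1; apply: le_trans (proxZ_perturbation _ _ _ (gam0 n) hf fus) _.
  rewrite lerD2r (_ : _ - _ = - (gam n *: a1 n)).
    by rewrite normrN normrZ gtr0_norm// ler_wpM2r.
  by rewrite hy1; apply: inner_ext => t; rewrite !innerE; ring.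
have d2 n : `|p2 n - P2 n| <= Gam * `|a2 n| + `|b2 n|.
  rewrite hp2; apply: le_trans (proxZ_perturbation _ _ _ (gam0 n) hcg cgs) _.
  rewrite lerD2r (_ : _ - _ = gam n *: a2 n).
    by rewrite normrZ gtr0_norm// ler_wpM2r.
  by rewrite hy2; apply: inner_ext => t; rewrite !innerE; ring.
have d_le n (a b : R) : 0 <= a -> 0 <= b -> a + b <= N n ->
    Gam * a + b <= C * N n.
  move=> a0' b0 abN; have N0 : 0 <= N n by lra.
  by rewrite /C; have : Gam * a <= Gam * N n by [rewrite ler_wpM2l//; lra]; nra.
have dC1 n : `|p1 n - P1 n| <= C * N n.
  apply: le_trans (d1 n) _; apply: d_le => //.
  by rewrite /N -addrA lerDl !addr_ge0.
have dC2 n : `|p2 n - P2 n| <= C * N n.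
  apply: le_trans (d2 n) _; apply: d_le => //.
  by rewrite /N addrCA lerDl addr_ge0// !addr_ge0.
have sE n : `|s n.+1 - (p n + gam n *: (B (s n) - B (p n)))| <= C * N n.
  have gamL : gam n * opnorm L <= 1 by have [_ h] := gamP n; lra.
  rewrite /s hx hv; apply: le_trans (kt_step_error hL (gam0 n) (gam_le n) gamL
    (hy1 n) (hy2 n) (hq1 n) (hq2 n) (d1 n) (d2 n)) _.
  have GM (w : R) : 0 <= w -> 0 <= Gam * w by move=> ?; rewrite mulr_ge0.
  have := GM _ (normr_ge0 (b1 n)); have := GM _ (normr_ge0 (b2 n)).
  have := GM _ (normr_ge0 (c1 n)); have := GM _ (normr_ge0 (c2 n)).
  have := normr_ge0 (c1 n); have := normr_ge0 (c2 n).
  have := normr_ge0 (a1 n); have := normr_ge0 (a2 n).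
  rewrite /C /N; lra.
have Ncvg : cvgn (series N).
  have serD (a b : nat -> R) : cvgn (series a) -> cvgn (series b) ->
      cvgn (series (fun n => a n + b n)) by exact: is_cvg_seriesD.
  exact: serD
    (serD _ _ (serD _ _ (absolutely_summable_cvg ha1)
       (absolutely_summable_cvg hb1)) (absolutely_summable_cvg hc1))
    (serD _ _ (serD _ _ (absolutely_summable_cvg ha2)
       (absolutely_summable_cvg hb2)) (absolutely_summable_cvg hc2)).
have ecvg : cvgn (series (fun n => C * N n)).
  by have := @is_cvg_seriesZ R N C Ncvg.
have eps01 : 0 < eps < 1 by rewrite eps0.
have Z0 : exists s0, kt_operator f g z r s0 (- kt_skew L s0).
  by exists (xs, ws); apply/(kt_zeroP _ _ _ _ hg gws); rewrite /= -us_E.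
have Amon : monotone_operator (kt_operator f g z r).
  exact: kt_operator_monotone hf hg _ _ gws.
have Ares : everywhere_resolvent (kt_operator f g z r).
  exact: kt_operator_resolvent hf hg _ _ _ _ fus gws.
have sp := fbf_residual Amon (kt_skewP hL) (kt_skew_le hL) (ltW beta0)
  eps01 gamP Apu sE ecvg Z0.
have [[xbar vbar] [Az swk pwk res]] := fbf_weak_cvg Amon Ares (kt_skewP hL)
  (kt_skew_le hL) (ltW beta0) eps01 gamP Apu sE ecvg Z0.
have /= [fx gx] := (kt_zeroP f L z r hg gws (xbar, vbar)).1 Az.
have gcx := subdifferential_conjugate hg gx.
exists xbar, vbar; split.
  split=> //; first exact: kuhn_tucker_primal fx gx.
  exact: kuhn_tucker_dual fx gx.
have xP1 : x n - P1 n @[n --> \oo] --> (0 : H).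
  exact: hprod_cvg1 sp.
have vP2 : v n - P2 n @[n --> \oo] --> (0 : G).
  exact: hprod_cvg2 sp.
have e_cvg0 : C * N n @[n --> \oo] --> 0 := cvg_series_cvg_0 ecvg.
have pP1 : p1 n - P1 n @[n --> \oo] --> (0 : H).
  apply/cvgr0Pnorm_lt => d d0; near=> n.
  by apply: le_lt_trans (dC1 n) _; near: n; exact: cvgr_lt d0.
have pP2 : p2 n - P2 n @[n --> \oo] --> (0 : G).
  apply/cvgr0Pnorm_lt => d d0; near=> n.
  by apply: le_lt_trans (dC2 n) _; near: n; exact: cvgr_lt d0.
have xp1 : x n - p1 n @[n --> \oo] --> (0 : H).
  apply: (cvg_close _ xP1); rewrite -[0]oppr0.
  under eq_fun do rewrite opprB addrC -addrA addKr -opprB.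
  exact: cvgN.
have vp2 : v n - p2 n @[n --> \oo] --> (0 : G).
  apply: (cvg_close _ vP2); rewrite -[0]oppr0.
  under eq_fun do rewrite opprB addrC -addrA addKr -opprB.
  exact: cvgN.
have xwk : weak_cvg x xbar := weak_cvg_hprod1 swk.
have vwk : weak_cvg v vbar := weak_cvg_hprod2 swk.
have fP1 n : subdifferential f (P1 n) ((u n).1 + z) by have [] := Apu n.
have gP2 n : subdifferential (conjugate g) (P2 n) ((u n).2 - r).
  by have [] := Apu n.
(* The quantity that vanishes in the limit is the sum of two monotonicity gaps. *)
have mono1 n : 0 <= '[P1 n - xbar, (u n).1 + z - (z - adjoint L vbar)].
  exact: subdifferential_monotone hf (fP1 n) fx.
have mono2 n : 0 <= '[P2 n - vbar, (u n).2 - r - (L xbar - r)].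
  exact: subdifferential_monotone hcg (gP2 n) gcx.
have resE n : '[p n - (xbar, vbar), u n + B (xbar, vbar)] =
    '[P1 n - xbar, (u n).1 + z - (z - adjoint L vbar)] +
    '[P2 n - vbar, (u n).2 - r - (L xbar - r)].
  have -> : (u n).1 + z - (z - adjoint L vbar) = (u n).1 + adjoint L vbar.
    by rewrite opprB [adjoint _ _ - z]addrC addrA addrK.
  have -> : (u n).2 - r - (L xbar - r) = (u n).2 - L xbar.
    by rewrite opprB addrA subrK.
  by rewrite hprod_innerE.
split=> //.
- by split=> //; [exact: weak_cvg_add0 xwk xp1|exact: weak_cvg_add0 vwk vp2].
- move=> fuc.
  have res1 : '[P1 n - xbar, (u n).1 + z - (z - adjoint L vbar)]
      @[n --> \oo] --> (0 : R).
    apply: (squeeze_cvgr _ (cvg_cst 0) res).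
    by apply: nearW => n; rewrite mono1 resE lerDl mono2.
  have P1x := uniformly_convex_cvg hf fuc fx fP1 res1.
  have p1x : p1 @ \oo --> xbar.
    exact: cvg_close pP1 P1x.
  by split=> //; exact: cvg_close xp1 p1x.
- move=> guc.
  have res2 : '[P2 n - vbar, (u n).2 - r - (L xbar - r)]
      @[n --> \oo] --> (0 : R).
    apply: (squeeze_cvgr _ (cvg_cst 0) res).
    by apply: nearW => n; rewrite mono2 resE lerDr mono1.
  have P2v := uniformly_convex_cvg hcg guc gcx gP2 res2.
  have p2v : p2 @ \oo --> vbar.
    exact: cvg_close pP2 P2v.
  by split=> //; exact: cvg_close vp2 p2v.
Unshelve. all: by end_near. Qed.
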